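(* Every locally complete locally convex space $E$ has the property $(MK)$.
   Context: A locally convex space $E$ is locally complete if the closed absolutely convex hull of any null sequence (sequence converging to $0$) in $E$ is compact. A null sequence $(x_n)_n$ in a topological vector space $E$ is a $K$-sequence if every subsequence of $(x_n)_n$ contains a subsequence $(y_n)_n$ such that the series $\sum_n y_n$ converges in $E$. A sequence $(x_n)_n$ in $E$ is Mackey null if there exists an increasing unbounded sequence $(a_n)_n$ of positive numbers such that $a_n x_n\to 0$ in $E$. $E$ has the property $(MK)$ if every Mackey null sequence in $E$ is a $K$-sequence. *)

(* Defs.v *)
From HB Require Import structures.
From mathcomp Require Import all_boot all_order all_algebra.
From mathcomp Require Import complex.
From mathcomp Require Import all_classical all_reals all_analysis.

Set Implicit Arguments.
Unset Strict Implicit.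
Unset Printing Implicit Defensive.

Import Order.TTheory GRing.Theory Num.Theory.

Local Open Scope classical_set_scope.
Local Open Scope ring_scope.

(* The library's [tvsType K] is a locally convex space over K; it is not
   assumed to be Hausdorff. Only the topology of E is used below, not the
   uniform structure bundled in [tvsType]. *)

Section LocallyConvexSpace.
Variables (K : numFieldType) (E : tvsType K).

Definition balanced (A : set E) : Prop :=
  forall (t : K) (x : E), `|t| <= 1 -> A x -> A (t *: x).

Definition absolutely_convex (A : set E) : Prop := convex_set A /\ balanced A.

Definition absolutely_convex_hull (X : set E) : set E :=
  smallest absolutely_convex X.

Definition null_sequence (x : E ^nat) : Prop := x @ \oo --> (0 : E).

Definition locally_complete : Prop :=
  forall x : E ^nat, null_sequence x ->
    compact (closure (absolutely_convex_hull (range x))).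

Definition K_sequence (x : E ^nat) : Prop :=
  null_sequence x /\
  forall phi : nat -> nat, increasing_seq phi ->
    exists2 psi : nat -> nat, increasing_seq psi &
      exists l : E, series (x \o phi \o psi) @ \oo --> l.

(* In a [numFieldType] such as R[i], [0 < a n] forces a n to be real, so a is a
   sequence of positive real numbers for K = R as well as for K = R[i]. *)
Definition Mackey_null (x : E ^nat) : Prop :=
  exists a : K ^nat,
    [/\ forall n, 0 < a n,
        nondecreasing_seq a,
        ~ has_ubound (range a) &
        null_sequence (fun n => a n *: x n)].

Definition property_MK : Prop :=
  forall x : E ^nat, Mackey_null x -> K_sequence x.

End LocallyConvexSpace.

Arguments locally_complete {K} E.
Arguments property_MK {K} E.

(* Main.v *)
Require Import Defs.
From HB Require Import structures.
From mathcomp Require Import all_boot all_order all_algebra.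
From mathcomp Require Import complex.
From mathcomp Require Import all_classical all_reals all_analysis.

Set Implicit Arguments.
Unset Strict Implicit.
Unset Printing Implicit Defensive.

(** Why the result holds. Let [a n *: x n] tend to 0 with [a] increasing and
    unbounded.  Along a suitable subsequence [a] dominates [2 ^+ n.+1], so the
    terms of the extracted series read [c n *: z n], where [z n] is a subsequence
    of [a n *: x n], hence a null sequence, and the positive weights
    [c n], the inverses of the corresponding terms of [a], add up to at most 1 over every interval of indices.

    A sum of points of a convex set containing 0, with such weights, stays in that
    set ([convex_set_sum]).  This is used twice in
    [locally_complete_series_cvg].  Applied to the absolutely convex hull of the
    range of [z], it puts all partial sums in a set whose closure is compact by
    local completeness, so that they have a cluster point.  Applied to small
    convex neighbourhoods of 0, which contain [z k] for all large [k], it shows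
    that the partial sums are Cauchy.  A Cauchy sequence converges to each of its
    cluster points ([Cauchy_cluster_cvg]).

    The real and the complex case are instances of [locally_complete_MK], whose
    scalars form any numeric field: [a] and the weights take nonnegative values,
    and nonnegative elements are comparable there, as in [R[i]]. *)

Import Order.TTheory GRing.Theory Num.Theory.

Local Open Scope classical_set_scope.
Local Open Scope ring_scope.

Lemma convex_set_conv (K : numFieldType) (M : lmodType K) (A : set M) (t : K)
    (x y : M) :
  convex_set A -> 0 <= t -> t <= 1 -> A x -> A y ->
  A (t *: x + (1 - t) *: y).
Proof.
move=> cA t0 t1 Ax Ay.
have := cA x y (Itv01 t0 t1); rewrite !inE; exact.
Qed.

Lemma convex_setZ (K : numFieldType) (M : lmodType K) (A : set M) (t : K)
    (x : M) :
  convex_set A -> A 0 -> 0 <= t -> t <= 1 -> A x -> A (t *: x).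
Proof.
move=> cA A0 t0 t1 Ax.
by rewrite -[t *: x]addr0 -(scaler0 M (1 - t)); exact: convex_set_conv.
Qed.

(** The invariant of the induction is that a partial sum equals its total weight
    times a point of [A]: adding a term then amounts to one convex combination
    after dividing by the new total weight.  Finally, 0 receives the weight that the
    total leaves short of 1. *)
Lemma convex_set_sum (K : numFieldType) (M : lmodType K) (A : set M)
    (I : Type) (r : seq I) (P : pred I) (c : I -> K) (z : I -> M) :
  convex_set A -> A 0 ->
  (forall i, P i -> 0 <= c i) -> (forall i, P i -> A (z i)) ->
  \sum_(i <- r | P i) c i <= 1 -> A (\sum_(i <- r | P i) c i *: z i).
Proof.
move=> cA A0 c0 Az.
pose spec (s : K) (x : M) := 0 <= s /\ exists2 w, A w & x = s *: w.
suff [s0 [w Aw ->]] :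
    spec (\sum_(i <- r | P i) c i) (\sum_(i <- r | P i) c i *: z i).
  by move=> s1; exact: convex_setZ.
apply: big_ind2 => [|s1 x s2 y [s10 [v Av ->]] [s20 [w Aw ->]]|i Pi].
- by split=> //; exists 0; rewrite ?scaler0.
- split; first exact: addr_ge0.
  (* With zero total weight there is nothing to divide by, but then both
     partial sums vanish. *)
  have [/eqP|s_neq0] := eqVneq (s1 + s2) 0.
    rewrite paddr_eq0// => /andP[/eqP -> /eqP ->].
    by exists 0; rewrite // !scale0r ?scaler0 addr0.
  have s_gt0 : 0 < s1 + s2 by rewrite lt0r s_neq0 addr_ge0.
  exists ((s1 / (s1 + s2)) *: v + (1 - s1 / (s1 + s2)) *: w).
    apply: convex_set_conv => //; first by rewrite divr_ge0 // ltW.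
    by rewrite ler_pdivrMr// mul1r lerDl.
  rewrite scalerDr !scalerA mulrBr mulr1 mulrCA divff// mulr1.
  by rewrite [s1 + s2]addrC addrK.
- by split; [exact: c0|exists (z i); [exact: Az|]].
Qed.

Section LocallyConvex.
Variables (K : numFieldType) (E : tvsType K).
Implicit Types (x z s : E ^nat) (U : set E).

(** Such a [V] contains 0, so by [convex_set_sum] it absorbs sums with nonnegative
    weights of total at most 1. *)
Lemma nbhs0_convex U : nbhs (0 : E) U ->
  exists V : set E, [/\ convex_set V, nbhs (0 : E) V & V `<=` U].
Proof.
move=> U0; have [B cB [Bo Bb]] := @locally_convex K E.
have [V [BV V0] VU] := Bb 0 U U0.
exists V; split=> //; first by apply: cB; rewrite inE.
by apply: open_nbhs_nbhs; split=> //; exact: Bo.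
Qed.

Lemma null_sequenceZ (r : K) x :
  r != 0 -> null_sequence x -> null_sequence (fun n => r *: x n).
Proof.
move=> r0 x0 U U0.
have ri0 : r^-1 != 0 by rewrite invr_eq0.
have := x0 _ (nbhs0Z ri0 U0); apply: (@filterS _ \oo) => n /= [y Uy /esym ->].
by rewrite scalerA mulfV// scale1r.
Qed.

Lemma null_sequence_scale_le1 (c : K ^nat) x :
  (forall n, 0 <= c n) -> (forall n, c n <= 1) ->
  null_sequence x -> null_sequence (fun n => c n *: x n).
Proof.
move=> c0 c1 x0 U /nbhs0_convex[V [cV V0 VU]].
have := x0 _ V0; apply: (@filterS _ \oo) => n /= Vx.
by apply: VU; apply: convex_setZ => //; exact: nbhs_singleton.
Qed.

Lemma null_sequence_subseq x (phi : nat -> nat) :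
  (forall n, (n <= phi n)%N) -> null_sequence x -> null_sequence (x \o phi).
Proof.
move=> nphi x0 U U0; have [N _ xU] := x0 _ U0.
by exists N => // n /= Nn; apply: xU => /=; exact: leq_trans (nphi n).
Qed.

(** Continuity of addition at [(0, l)] puts some [V + W] inside a given neighbourhood of [l]:
    some late term lies in [W] because [l] is a cluster point, and all later terms
    differ from it by elements of [V]. *)
Lemma Cauchy_cluster_cvg s (l : E) :
  (forall U, nbhs (0 : E) U -> exists N, forall m n,
     (N <= m)%N -> (m <= n)%N -> U (s n - s m)) ->
  cluster (s @ \oo) l -> s @ \oo --> l.
Proof.
move=> Cs sl U Ul.
have [[V W]/= [V0 Wl] VWU] : nbhs ((0, l) : E * E) [set p | U (p.1 + p.2)].
  by apply: (@add_continuous E (0, l)) => /=; rewrite add0r.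
have [N sN] := Cs _ V0.
have [_ [[m /= Nm <-] Wm]] :
    (s @` [set m | (N <= m)%N]) `&` W !=set0.
  apply: sl => //; exists N => // m Nm /=; by exists m.
exists m => // n /= mn.
by rewrite -[s n](subrK (s m)); apply: (VWU (_, _)); split=> //=; exact: sN.
Qed.

Lemma absolutely_convex_hull_absolutely_convex (X : set E) :
  absolutely_convex (absolutely_convex_hull X).
Proof.
split=> [x y t|t x t1 hx].
  rewrite !inE => hx hy A hA; have [[cA _] _] := hA.
  by rewrite -inE; apply: cA; rewrite inE; [exact: hx|exact: hy].
by move=> A hA; have [[_ bA] _] := hA; apply: bA => //; exact: hx.
Qed.

Lemma absolutely_convex_hull_sub (X : set E) :
  X `<=` absolutely_convex_hull X.
Proof. by move=> x Xx A [_]; exact. Qed.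

End LocallyConvex.

Lemma sum_sub_geometric_le1 (K : numFieldType) (c : K ^nat) m n :
  (forall k, c k <= 2^-1 ^+ k.+1) -> \sum_(m <= k < n) c k <= 1.
Proof.
move=> c_le; have [nm|/ltnW mn] := leqP n m; first by rewrite big_geq.
apply: (le_trans (ler_sum _ (fun k _ => c_le k))).
(* 2^-(k+1) = 2^-k - 2^-(k+1), so the geometric sum telescopes. *)
rewrite (telescope_sumr_eq (fun k => - 2^-1 ^+ k)) => // [|k _]; last first.
  rewrite opprK addrC exprS -{2}[_ ^+ k]mul1r -mulrBl; congr (_ * _).
  by rewrite {2}(splitr 1) mul1r addrK.
rewrite opprK addrC lerBlDr; apply: (@le_trans _ _ 1).
  by rewrite exprn_ile1 ?invr_ge0 ?invf_le1 ?ler1n.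
by rewrite lerDl exprn_ge0 ?invr_ge0.
Qed.

(** The core of the proof: the compact closed hull supplies the limit, as a cluster
    point of the partial sums, and local convexity supplies the Cauchy property. *)
Lemma locally_complete_series_cvg (K : numFieldType) (E : tvsType K)
    (c : K ^nat) (z : E ^nat) :
  locally_complete E -> null_sequence z ->
  (forall n, 0 <= c n) -> (forall n, c n <= 2^-1 ^+ n.+1) ->
  exists l : E, series (fun n => c n *: z n) @ \oo --> l.
Proof.
move=> lcE z0 c0 cle.
set H := absolutely_convex_hull (range z).
have [cH bH] := absolutely_convex_hull_absolutely_convex (range z).
have Hz k : H (z k) by apply: absolutely_convex_hull_sub; exists k.
have H0 : H 0.
  by rewrite -(scale0r (z 0%N)); apply: (bH 0 (z 0%N) _ (Hz _)); rewrite normr0 ler01.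
have Hs n : H (series (fun n => c n *: z n) n).
  by apply: convex_set_sum => //; exact: sum_sub_geometric_le1.
have [|l [_ sl]] := lcE z z0 (series (fun n => c n *: z n) @ \oo) _.
  by exists 0%N => // n _; apply: subset_closure; exact: Hs.
exists l; apply: Cauchy_cluster_cvg sl => U /nbhs0_convex[V [cV V0 VU]].
have [N _ zV] := z0 _ V0; exists N => m n Nm mn; apply: VU.
rewrite sub_series_geq// big_nat; apply: convex_set_sum => //.
- exact: nbhs_singleton.
- by move=> k /andP[mk _]; apply: zV => /=; exact: leq_trans mk.
- by rewrite -big_nat; exact: sum_sub_geometric_le1.
Qed.

Lemma increasing_seq_ge_id (phi : nat -> nat) (n : nat) :
  increasing_seq phi -> (n <= phi n)%N.
Proof.
move=> /increasing_seqP phi_lt; elim: n => // n IH.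
exact: leq_ltn_trans IH (phi_lt n).
Qed.

Lemma increasing_seq_dominating (f : nat -> nat) :
  exists2 psi : nat -> nat, increasing_seq psi & forall n, (f n <= psi n)%N.
Proof.
(* The partial sums of the (f i).+1 increase strictly and exceed each term. *)
exists (fun n => \sum_(i < n.+1) (f i).+1)%N.
  apply/increasing_seqP => n.
  by rewrite [ltRHS]big_ord_recr/= ltEnat/= -addSnnS leq_addr.
by move=> n; rewrite big_ord_recr/= addnS ltnW// ltnS leq_addl.
Qed.

(** In a numeric field that is only partially ordered, failing to be an upper
    bound gives a strictly larger value because positive elements are real and
    hence comparable. *)
Lemma unbounded_real_gt (K : numFieldType) (a : K ^nat) (M : K) :
  (forall n, 0 < a n) -> 0 <= M -> ~ has_ubound (range a) ->
  exists n, M < a n.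
Proof.
move=> a0 M0 ubd; apply: contrapT => aM; apply: ubd; exists M => _ [n _ <-].
rewrite real_leNgt ?(ger0_real M0) ?(gtr0_real (a0 n))//.
by apply/negP => Ma; apply: aM; exists n.
Qed.

Lemma locally_complete_MK (K : numFieldType) (E : tvsType K) :
  locally_complete E -> property_MK E.
Proof.
move=> lcE x [a [a_gt0 a_nd a_ubd ax0]].
split=> [|phi phi_incr].
  (* Since a 0 <= a n, the sequence x is a null sequence scaled by factors in
     [0, 1], once a n *: x n has been divided by the constant a 0. *)
  have a00 := a_gt0 0%N.
  have -> : x = fun n => (a 0%N / a n) *: ((a 0%N)^-1 *: (a n *: x n)).
    apply/funext => n; rewrite !scalerA mulrAC mulfVK ?gt_eqF// mulrC.
    by rewrite mulVf ?gt_eqF// scale1r.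
  apply: null_sequence_scale_le1 => [n|n|].
  - by rewrite divr_ge0// ltW.
  - by rewrite ler_pdivrMr// mul1r a_nd.
  - by apply: null_sequenceZ; rewrite // invr_eq0 gt_eqF.
have /choice[f af] n : exists N, 2 ^+ n.+1 < a N.
  by apply: unbounded_real_gt => //; exact: exprn_ge0.
have [psi psi_incr f_psi] := increasing_seq_dominating f.
exists psi => //.
pose g := phi \o psi.
have psi_g n : (psi n <= g n)%N by exact: increasing_seq_ge_id.
have a_g n : 2 ^+ n.+1 <= a (g n).
  apply: (le_trans (ltW (af n))); apply: a_nd.
  exact: leq_trans (f_psi n) (psi_g n).
have -> : x \o phi \o psi = fun n => (a (g n))^-1 *: (a (g n) *: x (g n)).
  by apply/funext => n /=; rewrite scalerA mulVf ?scale1r// gt_eqF.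
apply: locally_complete_series_cvg => // [|n|n].
- apply: (null_sequence_subseq (phi := g)) ax0 => n.
  exact: leq_trans (increasing_seq_ge_id n psi_incr) (psi_g n).
- by rewrite invr_ge0 ltW.
- by rewrite exprVn lef_pV2// posrE ?exprn_gt0.
Qed.

Local Open Scope complex_scope.

Theorem proposition2p2 (R : realType) :
  (forall E : tvsType R, locally_complete E -> property_MK E) /\
  (forall E : tvsType R[i], locally_complete E -> property_MK E).
Proof. by split=> E; exact: locally_complete_MK. Qed.
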